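(* Let $n \ge 2$, let $S_1, S_2 \subset \mathbb{R}$ with $|S_1| = |S_2| = n$ and $0 \in S_1 \cap S_2$, and let $\Gamma = S_1 \times S_2 \subset \mathbb{R}^2$. Then, for any integer $k \ge 2$: (a) $\operatorname{cov}_k(\Gamma) \le \left\lceil \frac{3}{2}k \right\rceil (n-1)$. (b) $\operatorname{cov}_k(\Gamma) \ge (10 - 4\sqrt{5} + o(1))\,k(n-1)$, where the asymptotics are for $n \to \infty$. (c) If $\Gamma$ is $\Delta$-generic for some $\Delta \ge 0$, then \[ \operatorname{cov}_k(\Gamma) \ge \left[ 2 - \frac{n-1}{2(n-1) - \Delta} \right] k(n-1). \]
   Context: For finite $S_1, S_2 \subseteq \mathbb{R}$ with $0 \in S_1 \cap S_2$, let $\Gamma = S_1 \times S_2$. For an integer $k \ge 1$, a $k$-cover of $\Gamma$ is a multiset $\mathcal{H}$ of (affine) lines in $\mathbb{R}^2$ such that every point of $\Gamma \setminus \{(0,0)\}$ is contained in at least $k$ of the lines (counted with multiplicity), while no line of $\mathcal{H}$ contains $(0,0)$. $\operatorname{cov}_k(\Gamma)$ denotes the minimum cardinality (counted with multiplicity) of a $k$-cover of $\Gamma$. A point of $\Gamma$ is a boundary point if at least one of its coordinates equals $0$, and an interior point otherwise. For an integer $\Delta \ge 0$, $\Gamma$ is called $\Delta$-generic if any line containing two boundary points of $\Gamma$ contains at most $\Delta$ interior points of $\Gamma$. In (b), $o(1)$ denotes a quantity that tends to $0$ as $n \to \infty$.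
   Formalization: In (c) the hypothesis Δ < 2(n−1) is added: for Δ = 2(n−1) the formula is undefined, and for Δ > 2(n−1) every Γ is Δ-generic while the claimed bound exceeds 2k(n−1), contradicting (a). *)

(* Defs.v *)
From mathcomp Require Import all_boot all_order all_algebra.
From mathcomp Require Import finmap multiset.
From mathcomp Require Import all_classical all_reals all_analysis.

Set Implicit Arguments.
Unset Strict Implicit.
Unset Printing Implicit Defensive.

Import Order.TTheory GRing.Theory Num.Theory.
Import numFieldNormedType.Exports.

Local Open Scope mset_scope.
Local Open Scope fset_scope.
Local Open Scope classical_set_scope.
Local Open Scope ring_scope.

Definition is_line (R : realType) (L : set (R * R)) : Prop :=
  exists a b c : R,
    (a, b) <> (0, 0) /\ L = [set p : R * R | a * p.1 + b * p.2 = c].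

(* [count] and [size] act on the enumeration of the multiset [H], in which
   each line is repeated according to its multiplicity. *)
Definition is_cover (R : realType) (k : nat) (G : {fset R * R})
    (H : {mset (set (R * R))}) : Prop :=
  [/\ forall L, L \in H -> is_line L,
      forall L, L \in H -> ~ L (0, 0)
    & forall p, p \in G -> p != (0, 0) ->
        (k <= count (fun L : set (R * R) => p \in L) H)%N].

Lemma is_line_off_origin (R : realType) (p : R * R) : p != (0, 0) ->
  exists L : set (R * R), [/\ is_line L, ~ L (0, 0) & L p].
Proof.
case: p => x y nz0; have [x0|x0] := eqVneq x 0.
- have y0 : y != 0 by apply: contraNneq nz0 => ->; rewrite x0.
  exists [set p | 0 * p.1 + 1 * p.2 = y]; split.
  + exists 0, 1, y; split=> // -[/eqP]; by rewrite oner_eq0.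
  + by rewrite /= !mulr0 addr0 => /esym/eqP; rewrite (negbTE y0).
  + by rewrite /= mul0r add0r mul1r.
- exists [set p | 1 * p.1 + 0 * p.2 = x]; split.
  + exists 1, 0, x; split=> // -[/eqP]; by rewrite oner_eq0.
  + by rewrite /= !mulr0 addr0 => /esym/eqP; rewrite (negbTE x0).
  + by rewrite /= mul0r addr0 mul1r.
Qed.

Lemma is_cover_exists (R : realType) (k : nat) (G : {fset R * R}) :
  exists H : {mset (set (R * R))}, is_cover k G H.
Proof.
suff [s [s1 s2 s3]] : exists s : seq (set (R * R)),
  [/\ forall L, L \in s -> is_line L, forall L, L \in s -> ~ L (0, 0)
    & forall p, p \in (G : seq _) -> p != (0, 0) ->
        (k <= count (fun L : set (R * R) => p \in L) s)%N].
  have /permP cs := perm_eq_seq_mset s.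
  exists (seq_mset s); split=> [L|L|p pG p0].
  - by rewrite (perm_mem (perm_eq_seq_mset s)); exact: s1.
  - by rewrite (perm_mem (perm_eq_seq_mset s)); exact: s2.
  - by rewrite cs; exact: s3.
elim: (G : seq _) => [|q g [s [s1 s2 s3]]]; first by exists [::]; split.
have [q0|q0] := eqVneq q (0, 0).
  exists s; split=> // p; rewrite inE => /orP[/eqP ->|]; last exact: s3.
  by rewrite q0 eqxx.
have [L [L1 L2 L3]] := is_line_off_origin q0.
exists (nseq k L ++ s); split=> [M|M|p].
- by rewrite mem_cat mem_nseq => /orP[/andP[_ /eqP ->]|/s1].
- by rewrite mem_cat mem_nseq => /orP[/andP[_ /eqP ->]|/s2].
- rewrite inE count_cat count_nseq => /orP[/eqP -> _|pg p0].
    by rewrite (mem_set L3) mul1n leq_addr.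
  by rewrite (leq_trans (s3 p pg p0)) // leq_addl.
Qed.

Lemma cover_size_exists (R : realType) (k : nat) (G : {fset R * R}) :
  exists m : nat, `[< exists H : {mset (set (R * R))},
    is_cover k G H /\ size H = m >].
Proof.
have [H Hc] := is_cover_exists k G.
by exists (size H); apply/asboolP; exists H.
Qed.

Definition cov (R : realType) (k : nat) (G : {fset R * R}) : nat :=
  ex_minn (cover_size_exists k G).

Definition boundary (R : realType) (p : R * R) : bool :=
  (p.1 == 0) || (p.2 == 0).

Definition generic (R : realType) (Delta : nat) (G : {fset R * R}) : Prop :=
  forall L : set (R * R), is_line L ->
    (exists p q : R * R, [/\ p \in G, q \in G & p != q] /\
       [/\ boundary p, boundary q, L p & L q]) ->
    (#|` [fset r in G | ~~ boundary r && (r \in L)]| <= Delta)%N.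

(* Main.v *)
Require Import Defs.
From mathcomp Require Import all_boot all_order all_algebra.
From mathcomp Require Import finmap multiset.
From mathcomp Require Import all_classical all_reals all_analysis.
From mathcomp Require Import zify ring lra.

Set Implicit Arguments.
Unset Strict Implicit.
Unset Printing Implicit Defensive.

Import Order.TTheory GRing.Theory Num.Theory.
Import numFieldNormedType.Exports.

Local Open Scope mset_scope.
Local Open Scope fset_scope.
Local Open Scope classical_set_scope.
Local Open Scope ring_scope.

(** Let A and B be S1 and S2 without 0, both of size m = n - 1.

    Upper bound. Three families of m lines suffice: the vertical lines through
    the points of A, the horizontal lines through the points of B, and the lines
    joining (s_i, 0) to (0, t_i) for a bijection s_i <-> t_i of A with B. An
    interior point meets the first two families, a boundary point the third and
    one of the others. So ceil(k/2) copies of each of the first two and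
    floor(k/2) copies of the third cover every point k times, which makes
    ceil(3k/2) m lines ([cov_upper]).

    Lower bounds. Covering is a linear programme, so by weak duality
    nonnegative weights on the points, such that every line avoiding the origin
    has total weight at most 1, force at least k times the total weight many
    lines. Every interior point gets the same weight w. A line avoiding the
    origin has at most one point on each axis and at most m interior points.
    Hence the only constraints are f + w m <= 1 for a boundary weight f, and
    f(s) + g(t) + w N(s, t) <= 1, where N(s, t) is the number of interior points
    on the line through (s, 0) and (0, t) ([weighted_cov]).

    If N <= Delta, one takes w = 1 / (2 m - Delta) and f = g = 1 - w m; the
    total is the bound of the generic case ([cov_lower_generic]).

    In general, call s rich if some line through (s, 0) and a point (0, t) has
    N(s, t) >= m - x m. Such a line is the graph of a monotone function, so it
    matches almost all of S1 with almost all of S2, preserving or reversing the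
    order, and it matches s with 0. So, up to the number of unmatched points,
    the rank of s in S1 is the number of negative elements of S2 (or of positive
    ones, if the slope is negative). Therefore the rich s lie in two windows of
    ranks, and there are at most 4 x m of them ([count_rich]). Now give the
    rich boundary points weight (1 - b) / 2, the other ones weight 1 - b, and
    w = b / m with b (1 + x) = 1. If N(s, t) >= m - x m then both end points are
    rich and the total is at most (1 - b) + b; otherwise it is at most
    2 (1 - b) + b (1 - x) = 1. The sum of all weights is at least
    m (1 + 2 x - 4 x^2) / (1 + x), whose maximum (10 - 4 sqrt 5) m is reached at
    x = sqrt 5 / 2 - 1 ([cov_lower]). No error term appears: the bound holds for
    every n, and o(1) can be taken to be zero. *)

(** * Lines through two boundary points *)

Definition diagonal {R : realType} (s t : R) : set (R * R) :=
  [set p | s^-1 * p.1 + t^-1 * p.2 = 1].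

Definition grid {R : realType} (A B : seq R) : seq (R * R) :=
  [seq (x, y) | x <- A, y <- B].

Definition incidences {R : realType} (A B : seq R) (s t : R) : nat :=
  count (fun p => p \in diagonal s t) (grid A B).

Lemma leq_count_uniq (T : eqType) (P : pred T) (s1 s2 : seq T) :
  uniq s1 -> {subset s1 <= s2} -> (count P s1 <= count P s2)%N.
Proof.
move=> u s12; rewrite -!size_filter; apply: uniq_leq_size.
  exact: filter_uniq.
by move=> x; rewrite !mem_filter => /andP[-> /s12].
Qed.

Lemma mem_grid (R : realType) (A B : seq R) p :
  (p \in grid A B) = (p.1 \in A) && (p.2 \in B).
Proof.
apply/allpairsP/andP => [[q [qA qB ->]] //|[pA pB]].
by exists p; split=> //; case: p pA pB.
Qed.

Lemma grid_uniq (R : realType) (A B : seq R) :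
  uniq A -> uniq B -> uniq (grid A B).
Proof. by move=> uA uB; apply: allpairs_uniq => // -[x y] [x' y'] _ _ /=. Qed.

Lemma in_diagonal (R : realType) (s t : R) (p : R * R) : s != 0 -> t != 0 ->
  (p \in diagonal s t) = (p.2 * s == t * (s - p.1)).
Proof.
move=> s0 t0; apply/idP/eqP; rewrite in_setE /diagonal /= => e.
  have -> : p.2 * s = t * s * (t^-1 * p.2) by field.
  have -> : t^-1 * p.2 = 1 - s^-1 * p.1 by rewrite -e; ring.
  by field.
have -> : p.2 = t * (s - p.1) / s by rewrite -e; field.
by field; rewrite s0.
Qed.

Lemma grid_line_inj (R : realType) (s t : R) : s != 0 -> t != 0 ->
  forall p q : R * R, p \in diagonal s t -> q \in diagonal s t ->
  (p.1 == q.1) = (p.2 == q.2).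
Proof.
move=> s0 t0 [x y] [x' y']; rewrite !in_diagonal //= => /eqP e /eqP e'.
apply/eqP/eqP => exy.
  by apply: (mulIf s0); rewrite e e' exy.
by apply: (can_inj (subKr s)); apply: (mulfI t0); rewrite -e -e' exy.
Qed.

(** * Few boundary points lie on rich lines *)

(** On a duplicate-free list the rank is injective, so a window of 2u + 1 ranks
    holds at most that many elements. *)
Lemma rank_window (R : realType) (S : seq R) (c u : nat) : uniq S ->
  (count (fun s => [&& c <= count (< s) S + u & count (< s) S <= c + u]%N) S
    <= u.*2.+1)%N.
Proof.
move=> uS; set rk := fun s => count (< s) S.
have rk_mono x y : x \in S -> x < y -> (rk x < rk y)%N.
  move=> xS xy; rewrite /rk.
  have -> : count (< y) S =
    (count (predI (< y) (< x)) S + count (predI (< y) (predC (< x))) S)%N.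
    have := count_predUI (predI (< y) (< x)) (predI (< y) (predC (< x))) S.
    rewrite [X in (_ + X)%N](_ : _ = 0%N); last first.
      apply/eqP; rewrite -leqn0 leqNgt -has_count; apply/hasPn => z _ /=.
      by case: (z < x); rewrite ?andbF.
    rewrite addn0 => <-; apply: eq_count => z /=.
    by case: (z < x); rewrite ?andbT ?andbF ?orbF.
  rewrite -addn1; apply: leq_add.
    apply: sub_count => z /= zx; rewrite zx andbT; exact: lt_trans zx xy.
  by rewrite -has_count; apply/hasP; exists x => //=; rewrite xy ltxx.
have rk_inj : {in S &, injective rk}.
  move=> x y xS yS e; case: (ltgtP x y) => // xy.
    by have := rk_mono _ _ xS xy; rewrite e ltnn.
  by have := rk_mono _ _ yS xy; rewrite e ltnn.
rewrite -size_filter -(size_map rk) -(size_iota (c - u) u.*2.+1).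
apply: uniq_leq_size.
  rewrite map_inj_in_uniq ?filter_uniq // => x y.
  by rewrite !mem_filter => /andP[_ xS] /andP[_ yS]; exact: rk_inj.
move=> _ /mapP[x + ->]; rewrite mem_filter => /andP[/andP[h1 h2] _].
rewrite mem_iota; move: h1 h2; rewrite -/(rk x); lia.
Qed.

(** [P] is a partial matching of [S1] with [S2] that exchanges [D] with [E].
    Only the at most [u] unmatched elements of [S1] can satisfy [D] without
    being paired with an element satisfying [E]. *)
Lemma matching_count (T : eqType) (S1 S2 : seq T) (P : seq (T * T))
    (D E : pred T) (u : nat) :
  uniq (map fst P) -> {subset map fst P <= S1} ->
  uniq (map snd P) -> {subset map snd P <= S2} ->
  (size S1 <= size P + u)%N ->
  (forall p, p \in P -> D p.1 = E p.2) ->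
  (count D S1 <= count E S2 + u)%N.
Proof.
move=> u1 s1 u2 s2 sz DE.
have h1 := leq_count_uniq (predC D) u1 s1.
have h2 := leq_count_uniq E u2 s2.
have e : count D (map fst P) = count E (map snd P).
  by rewrite !count_map; apply: eq_in_count => p /DE.
have := count_predC D S1; have := count_predC D (map fst P).
rewrite size_map; lia.
Qed.

Section Rank.
Context {R : realType} (A B : seq R) (s t : R).
Hypotheses (uA : uniq A) (uB : uniq B) (A0 : 0 \notin A) (B0 : 0 \notin B).
Hypotheses (sA : s \in A) (tB : t \in B).

Let S1 := 0 :: A.
Let S2 := 0 :: B.
Let P := [seq p <- grid S1 S2 | p \in diagonal s t].

Let s0 : s != 0. Proof. by apply: contraNneq A0 => <-. Qed.
Let t0 : t != 0. Proof. by apply: contraNneq B0 => <-. Qed.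

Let P1 : uniq (map fst P).
Proof.
rewrite map_inj_in_uniq ?filter_uniq ?grid_uniq //= ?A0 ?B0 //.
move=> [x y] [x' y']; rewrite !mem_filter => /andP[h _] /andP[h' _] /= e.
have := grid_line_inj s0 t0 h h'; rewrite /= e eqxx => /esym/eqP ->.
by [].
Qed.

Let P2 : uniq (map snd P).
Proof.
rewrite map_inj_in_uniq ?filter_uniq ?grid_uniq //= ?A0 ?B0 //.
move=> [x y] [x' y']; rewrite !mem_filter => /andP[h _] /andP[h' _] /= e.
have := grid_line_inj s0 t0 h h'; rewrite /= e eqxx => /eqP ->.
by [].
Qed.

Let P1S : {subset map fst P <= S1}.
Proof. by move=> _ /mapP[p + ->]; rewrite mem_filter mem_grid => /and3P[]. Qed.

Let P2S : {subset map snd P <= S2}.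
Proof. by move=> _ /mapP[p + ->]; rewrite mem_filter mem_grid => /and3P[]. Qed.

Let sizeP : (incidences A B s t + 2 <= size P)%N.
Proof.
rewrite /incidences -size_filter addn2.
set I := seq.filter _ _.
have -> : (size I).+2 = size [:: (s, 0), (0, t) & I] by [].
apply: uniq_leq_size.
  rewrite /= filter_uniq ?grid_uniq // andbT !inE !mem_filter !mem_grid /=.
  by rewrite (negPf A0) (negPf B0) !andbF orbF xpair_eqE (negPf s0).
move=> p; rewrite !inE mem_filter mem_grid => /or3P[/eqP->|/eqP->|].
- by rewrite mem_filter mem_grid !inE in_diagonal //= mul0r subrr mulr0 !eqxx
    sA orbT.
- by rewrite mem_filter mem_grid !inE in_diagonal //= subr0 !eqxx tB orbT.
- rewrite mem_filter => /andP[-> ]; rewrite !mem_grid !inE.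
  by move=> /andP[-> ->]; rewrite !orbT.
Qed.

(** Together with its two boundary points, the line has at most one point over
    each of the [size A + 1] abscissas. *)
Lemma incidences_lt : (incidences A B s t < size A)%N.
Proof.
have := uniq_leq_size P1 P1S; rewrite size_map /= => h.
by move: (leq_trans sizeP h); lia.
Qed.

(** The line matches [S1] with [S2] up to [u] points on each side. If its slope
    is negative, the points to the left of [(s, 0)] on the line are those above
    the axis, and if it is positive they are those below. Counting
    both sides of this bijection locates the rank of [s]. *)
Lemma rank_on_diagonal u : size A = size B ->
  (size A <= incidences A B s t + u.+1)%N ->
  let near c := [&& c <= count (< s) S1 + u & count (< s) S1 <= c + u]%N in
  near (count (> 0) S2) || near (count (< 0) S2).
Proof.
move=> sAB hN /=.
have sz1 : (size S1 <= size P + u)%N by move: sizeP hN => /=; lia.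
have sz2 : (size S2 <= size P + u)%N by move: sz1; rewrite /= sAB.
(* The mirrored matching gives the reverse inequality. *)
pose P' := [seq (p.2, p.1) | p <- P].
have e1 : map fst P' = map snd P by rewrite -map_comp; apply: eq_map.
have e2 : map snd P' = map fst P by rewrite -map_comp; apply: eq_map.
have key (E : pred R) : (forall p, p \in P -> (p.1 < s) = E p.2) ->
    ((count E S2 <= count (< s) S1 + u) && (count (< s) S1 <= count E S2 + u))%N.
  move=> h; apply/andP; split.
    apply: (matching_count (P := P')); rewrite ?e1 ?e2 ?size_map //.
    by move=> _ /mapP[p pP ->] /=; rewrite h.
  exact: (matching_count (P := P)).
have onP p : p \in P -> p.2 * s = t * (s - p.1).
  by rewrite mem_filter in_diagonal // => /andP[/eqP].
have : 0 < s * t \/ s * t < 0.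
  case: (ltgtP (s * t) 0); [by right|by left|move/eqP].
  by rewrite mulf_eq0 (negPf s0) (negPf t0).
have sq : 0 < s ^+ 2 by rewrite exprn_even_gt0.
case=> st; apply/orP; [left|right]; apply: key => p /onP e.
  rewrite -subr_gt0 -(pmulr_rgt0 _ st).
  have -> : s * t * (s - p.1) = p.2 * s ^+ 2 by rewrite -mulrA -e; ring.
  by rewrite pmulr_lgt0.
rewrite -subr_gt0 -(nmulr_rlt0 _ st).
have -> : s * t * (s - p.1) = p.2 * s ^+ 2 by rewrite -mulrA -e; ring.
by rewrite pmulr_llt0.
Qed.

End Rank.

(** By [rank_on_diagonal] a rich element has its rank in one of two windows,
    one for each sign of the slope, whose centres depend on [B] alone. *)
Lemma count_rich (R : realType) (A B : seq R) (r : nat) :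
  uniq A -> uniq B -> 0 \notin A -> 0 \notin B -> size A = size B ->
  (count (fun s => has (fun t => size A <= incidences A B s t + r)%N B) A
     <= 4 * r)%N.
Proof.
(* A line with at least [size A - r] interior points misses at most [r - 1]
   elements of [0 :: A], because its end point over [0] and the element [s]
   count as matched; hence the windows have width [2 (r - 1) + 1]. *)
move=> uA uB A0 B0 sAB; case: r => [|u].
  rewrite muln0 leqNgt -has_count; apply/hasPn => s sA; apply/hasPn => t tB.
  by rewrite addn0 -ltnNge incidences_lt.
pose near c s := ([&& c <= count (< s) (0%R :: A) + u
  & count (< s) (0%R :: A) <= c + u])%N.
have win c : (count (near c) A <= u.*2.+1)%N.
  apply: leq_trans (rank_window (S := 0 :: A) c u _); last by rewrite /= A0.
  by rewrite /= -/(near c 0) leq_addl.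
set c1 := count (> 0) (0 :: B); set c2 := count (< 0) (0 :: B).
apply: (@leq_trans (count (predU (near c1) (near c2)) A)).
  rewrite -!size_filter; apply: uniq_leq_size; first exact: filter_uniq.
  move=> s; rewrite !mem_filter => /andP[/hasP[t tB h] sA]; rewrite sA andbT.
  exact: rank_on_diagonal h.
have := count_predUI (near c1) (near c2) A.
have := win c1; have := win c2; lia.
Qed.

Lemma incidencesC (R : realType) (A B : seq R) (s t : R) :
  uniq A -> uniq B -> incidences A B s t = incidences B A t s.
Proof.
have le A' B' s' t' : uniq A' -> uniq B' ->
    (incidences A' B' s' t' <= incidences B' A' t' s')%N :> bool.
  move=> uA uB; rewrite /incidences -!size_filter.
  rewrite -(size_map (fun p => (p.2, p.1))); apply: uniq_leq_size.
    rewrite map_inj_uniq ?filter_uniq ?grid_uniq //.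
    by move=> [x y] [x' y'] [-> ->].
  move=> _ /mapP[p + ->]; rewrite !mem_filter !mem_grid /=.
  case/and3P=> h -> ->; rewrite !andbT; move: h.
  by rewrite !in_setE /diagonal /= => <-; rewrite addrC.
by move=> uA uB; apply/eqP; rewrite eqn_leq !le.
Qed.

(** * Weighted points bound covers from below *)

Lemma sum_const_count (R : pzRingType) (T : Type) (s : seq T) (P : pred T) (c : R) :
  \sum_(i <- s | P i) c = c * (count P s)%:R.
Proof. by rewrite big_const_seq iter_addr_0 mulr_natr. Qed.

Section WeightedPoints.
Context {R : realType} (k : nat) (G : {fset R * R}).

Lemma cov_attained : exists2 H, is_cover k G H & size H = cov k G.
Proof. by rewrite /cov; case: ex_minnP => m /asboolP[H [cH <-]] _; exists H. Qed.

Lemma cov_leq_size (s : seq (set (R * R))) :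
  (forall L, L \in s -> is_line L) -> (forall L, L \in s -> ~ L (0, 0)) ->
  (forall p, p \in G -> p != (0, 0) -> (k <= count (fun L => p \in L) s)%N) ->
  (cov k G <= size s)%N.
Proof.
move=> s1 s2 s3; rewrite /cov; case: ex_minnP => m _; apply; apply/asboolP.
have ps := perm_eq_seq_mset s.
exists (seq_mset s); rewrite (perm_size ps); split=> //.
split=> [L|L|p pG p0]; rewrite ?(perm_mem ps); [exact: s1|exact: s2|].
by rewrite (permP ps); exact: s3.
Qed.

(** Weak duality: each point is counted once for every line of the cover that
    contains it, that is, at least [k] times. *)
Lemma sum_weights_le (I : eqType) (r : seq I) (f : I -> R * R) (W : I -> R)
    (H : {mset (set (R * R))}) : is_cover k G H ->
  (forall i, i \in r -> [/\ f i \in G, f i != (0, 0) & 0 <= W i]) ->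
  k%:R * \sum_(i <- r) W i <= \sum_(L <- H) \sum_(i <- r | f i \in L) W i.
Proof.
move=> [_ _ cH] rW; under [leRHS]eq_bigr do rewrite big_mkcond.
rewrite exchange_big mulr_sumr [leLHS]big_seq [leRHS]big_seq /=.
apply: ler_sum => i /rW[fG f0 Wi]; rewrite -big_mkcond sum_const_count.
by rewrite mulrC ler_wpM2l // ler_nat cH.
Qed.

End WeightedPoints.

(** One of the two projections is injective on a line. *)
Lemma line_grid_count (R : realType) (A B : seq R) (L : set (R * R)) :
  uniq A -> uniq B -> size A = size B -> is_line L ->
  (count (fun p => p \in L) (grid A B) <= size A)%N.
Proof.
move=> uA uB sAB [a [b [c [ab ->]]]]; rewrite -size_filter.
have [b0|b0] := eqVneq b 0.
  have a0 : a != 0 by apply: contra_notN ab => /eqP ->; rewrite b0.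
  rewrite sAB -(size_map snd); apply: uniq_leq_size.
    rewrite map_inj_in_uniq ?filter_uniq ?grid_uniq // => -[x y] [x' y'].
    rewrite !mem_filter /= => /andP[h _] /andP[h' _] e; move: h h'.
    by rewrite e !in_setE /= => <- /addIr/(mulfI a0) ->.
  by move=> _ /mapP[p + ->]; rewrite mem_filter mem_grid => /and3P[].
rewrite -(size_map fst); apply: uniq_leq_size.
  rewrite map_inj_in_uniq ?filter_uniq ?grid_uniq // => -[x y] [x' y'].
  rewrite !mem_filter /= => /andP[h _] /andP[h' _] e; move: h h'.
  by rewrite e !in_setE /= => <- /addrI/(mulfI b0) ->.
by move=> _ /mapP[p + ->]; rewrite mem_filter mem_grid => /and3P[].
Qed.

Lemma line_through_axes (R : realType) (L : set (R * R)) (s t : R) :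
  is_line L -> ~ L (0, 0) -> L (s, 0) -> L (0, t) -> L = diagonal s t.
Proof.
move=> [a [b [c [_ ->]]]] /=; rewrite !mulr0 !addr0 add0r => /eqP.
rewrite eq_sym => c0 es et.
have s0 : s != 0 by apply: contraNneq c0 => e; rewrite -es e mulr0.
have t0 : t != 0 by apply: contraNneq c0 => e; rewrite -et e mulr0.
have -> : a = c * s^-1 by rewrite -es mulfK.
have -> : b = c * t^-1 by rewrite -et mulfK.
apply/seteqP; split=> p /=; rewrite -!mulrA -mulrDr.
  by rewrite -[X in _ = X]mulr1 => /(mulfI c0).
by move=> ->; rewrite mulr1.
Qed.

(** A line avoiding the origin meets each axis at most once, so the weight that
    it collects there is zero or a single value. *)
Lemma axis_sum (R : realType) (A : seq R) (P : pred R) (F : R -> R) :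
  uniq A -> {in A &, forall x y, P x -> P y -> x = y} ->
  \sum_(s <- A | P s) F s = 0 \/
  exists s, [/\ s \in A, P s & \sum_(s <- A | P s) F s = F s].
Proof.
move=> uA PA; have [/hasP[s sA Ps]|/hasPn nP] := boolP (has P A); [right|left].
  exists s; split=> //; rewrite big_mkcond (bigD1_seq s) //= Ps.
  rewrite big_seq_cond big1 ?addr0 // => x /andP[xA xs].
  by case: ifP => // Px; move: xs; rewrite (PA x s) ?eqxx.
by rewrite big_seq_cond big1 // => s /andP[/nP/negPf ->].
Qed.

(** The lines with at most one boundary point give the constraints on [f] and
    [g] alone; those with two are diagonals and give the joint constraint. *)
Lemma weighted_cov (R : realType) (k : nat) (G : {fset R * R}) (A B : seq R)
    (f g : R -> R) (w : R) :
  uniq A -> uniq B -> 0 \notin A -> 0 \notin B ->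
  size A = size B -> (0 < size A)%N ->
  {subset grid (0 :: A) (0 :: B) <= G} ->
  (forall s, s \in A -> 0 <= f s) -> (forall t, t \in B -> 0 <= g t) -> 0 <= w ->
  (forall s, s \in A -> f s + w * (size A)%:R <= 1) ->
  (forall t, t \in B -> g t + w * (size A)%:R <= 1) ->
  (forall s t, s \in A -> t \in B ->
     f s + g t + w * (incidences A B s t)%:R <= 1) ->
  k%:R * (\sum_(s <- A) f s + \sum_(t <- B) g t + w * (size A)%:R ^+ 2)
    <= (cov k G)%:R.
Proof.
move=> uA uB A0 B0 sAB mgt0 sG f0 g0 w0 fw gw fgw.
have [H cH <-] := cov_attained k G; have [Hl H0 _] := cH.
have -> : w * (size A)%:R ^+ 2 = \sum_(p <- grid A B) w.
  by rewrite sum_const_count count_predT size_allpairs -sAB natrM expr2.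
have inG p : p \in grid (0 :: A) (0 :: B) -> p \in G by exact: sG.
rewrite !mulrDr.
have hA := sum_weights_le (f := fun s => (s, 0)) (W := f) (r := A) cH.
have hB := sum_weights_le (f := fun t => (0, t)) (W := g) (r := B) cH.
have hI := sum_weights_le (f := fun p => p) (W := fun=> w) (r := grid A B) cH.
apply: le_trans (lerD (lerD (hA _) (hB _)) (hI _)) _.
- move=> s sA; split; last exact: f0.
    by apply: inG; rewrite mem_grid !inE sA orbT eqxx.
  by rewrite xpair_eqE eqxx andbT; apply: contraNneq A0 => <-.
- move=> t tB; split; last exact: g0.
    by apply: inG; rewrite mem_grid !inE tB orbT eqxx.
  by rewrite xpair_eqE eqxx /=; apply: contraNneq B0 => <-.
- move=> [x y]; rewrite mem_grid /= => /andP[xA yB]; split=> //.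
    by apply: inG; rewrite mem_grid !inE xA yB !orbT.
  by rewrite xpair_eqE; apply/nandP; left; apply: contraNneq A0 => <-.
have -> : (size H)%:R = \sum_(L <- H) (1 : R).
  by rewrite sum_const_count count_predT mul1r.
rewrite -!big_split /=.
rewrite [leLHS]big_seq [leRHS]big_seq; apply: ler_sum => L LH.
have lL := Hl _ LH; have L0 := H0 _ LH.
have ci : \sum_(p <- grid A B | p \in L) w =
    w * (count (fun p => p \in L) (grid A B))%:R.
  exact: sum_const_count.
have cm := line_grid_count uA uB sAB lL.
have wm : w * (count (fun p => p \in L) (grid A B))%:R <= w * (size A)%:R.
  by rewrite ler_wpM2l // ler_nat.
rewrite ci.
have [a [b [c [ab eL]]]] := lL.
have c0 : c != 0.
  by apply/eqP => c0; apply: L0; rewrite eL /= c0 !mulr0 addr0.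
have cancel z x y : z * x = c -> z * y = c -> x = y.
  move=> zx zy; have z0 : z != 0.
    by apply: contraNneq c0 => z0; rewrite -zx z0 mul0r.
  by apply: (mulfI z0); rewrite zx zy.
have uniA : {in A &, forall x y, (x, 0) \in L -> (y, 0) \in L -> x = y}.
  by move=> x y _ _; rewrite !in_setE eL /= mulr0 !addr0; exact: cancel.
have uniB : {in B &, forall x y, (0, x) \in L -> (0, y) \in L -> x = y}.
  by move=> x y _ _; rewrite !in_setE eL /= mulr0 !add0r; exact: cancel.
have [->|[s [sA sL ->]]] := axis_sum f uA uniA;
  have [->|[t [tB tL ->]]] := axis_sum g uB uniB.
- rewrite !add0r; apply: le_trans wm _; case: (A) mgt0 f0 fw => // s A' _ f0 fw.
  have sA : s \in s :: A' by rewrite mem_head.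
  by apply: le_trans (fw s sA); rewrite lerDr f0.
- by rewrite add0r; apply: le_trans (gw t tB); rewrite lerD2l.
- by rewrite addr0; apply: le_trans (fw s sA); rewrite lerD2l.
move: sL tL; rewrite !in_setE => sL tL.
by rewrite (line_through_axes lL L0 sL tL); exact: fgw.
Qed.

(** * A cover from axis-parallel lines and a matching *)

Definition vertical {R : realType} (s : R) : set (R * R) := [set p | p.1 = s].
Definition horizontal {R : realType} (t : R) : set (R * R) := [set p | p.2 = t].

Lemma vertical_line (R : realType) (s : R) : is_line (vertical s).
Proof.
exists 1, 0, s; split; first by case=> /eqP; rewrite oner_eq0.
by apply/seteqP; split=> p; rewrite /vertical /= mul1r mul0r addr0.
Qed.

Lemma horizontal_line (R : realType) (t : R) : is_line (horizontal t).
Proof.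
exists 0, 1, t; split; first by case=> /eqP; rewrite oner_eq0.
by apply/seteqP; split=> p; rewrite /horizontal /= mul1r mul0r add0r.
Qed.

Lemma diagonal_line (R : realType) (s t : R) : s != 0 -> is_line (diagonal s t).
Proof.
move=> s0; exists s^-1, t^-1, 1; split=> // -[/eqP].
by rewrite invr_eq0 (negPf s0).
Qed.

Lemma count_flatten_nseq (T : Type) (P : pred T) (c : nat) (s : seq T) :
  count P (flatten (nseq c s)) = (c * count P s)%N.
Proof. by rewrite count_flatten map_nseq sumn_nseq mulnC. Qed.

(** The cover consists of [uphalf k] copies of all vertical and horizontal lines
    and [k./2] copies of the diagonals of the matching [zip A B]. *)
Lemma cov_upper (R : realType) (k : nat) (G : {fset R * R}) (A B : seq R) :
  0 \notin A -> 0 \notin B -> size A = size B ->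
  {subset G <= grid (0 :: A) (0 :: B)} ->
  (cov k G <= (2 * uphalf k + k./2) * size A)%N.
Proof.
move=> A0 B0 sAB sG.
set V := map vertical A; set W := map horizontal B.
set D := [seq diagonal st.1 st.2 | st <- zip A B].
pose C := flatten (nseq (uphalf k) (V ++ W)) ++ flatten (nseq k./2 D).
have size_fl c (s : seq (set (R * R))) : size (flatten (nseq c s)) = (c * size s)%N.
  by rewrite -!count_predT count_flatten_nseq.
have -> : ((2 * uphalf k + k./2) * size A = size C)%N.
  rewrite size_cat !size_fl size_cat !size_map size_zip -sAB minnn; lia.
have memC L : L \in C -> [\/ L \in V, L \in W | L \in D].
  rewrite mem_cat => /orP[]/flattenP[s]; rewrite mem_nseq => /andP[_ /eqP->].
    by rewrite mem_cat => /orP[]; [constructor 1|constructor 2].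
  by constructor 3.
have memD st : st \in zip A B -> st.1 \in A.
  move=> h; rewrite -(unzip1_zip (s := A) (t := B)) ?sAB //.
  by apply/mapP; exists st.
apply: cov_leq_size => [L /memC|L /memC|].
- case=> /mapP[s sA ->]; [exact: vertical_line|exact: horizontal_line|].
  by apply: diagonal_line; apply: contraNneq A0 => <-; exact: memD.
- case=> /mapP[s sA ->] /=.
  + by rewrite /vertical /= => e; move: A0; rewrite e sA.
  + by rewrite /horizontal /= => e; move: B0; rewrite e sA.
  + by rewrite /diagonal /= !mulr0 addr0 => /esym/eqP; rewrite oner_eq0.
move=> p /sG; rewrite mem_grid !inE => pG p0.
pose cnt (s : seq (set (R * R))) := count (fun L => p \in L) s.
have -> : count (fun L => p \in L) C =
    (uphalf k * (cnt V + cnt W) + k./2 * cnt D)%N.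
  by rewrite count_cat !count_flatten_nseq count_cat.
have cV : p.1 \in A -> (0 < cnt V)%N.
  move=> pA; rewrite -has_count has_map; apply/hasP; exists p.1 => //=.
  by rewrite in_setE.
have cW : p.2 \in B -> (0 < cnt W)%N.
  move=> pB; rewrite -has_count has_map; apply/hasP; exists p.2 => //=.
  by rewrite in_setE.
have zipP i : (i < size A)%N -> nth (0, 0) (zip A B) i \in zip A B.
  by move=> h; rewrite mem_nth // size_zip -sAB minnn.
have cD1 : p.1 \in A -> p.2 = 0 -> (0 < cnt D)%N.
  move=> pA p2; rewrite -has_count has_map; apply/hasP.
  exists (nth (0, 0) (zip A B) (index p.1 A)); first by rewrite zipP ?index_mem.
  rewrite nth_zip //= nth_index // in_setE /diagonal /= p2 mulr0 addr0 mulVf //.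
  by apply: contraNneq A0 => <-.
have cD2 : p.2 \in B -> p.1 = 0 -> (0 < cnt D)%N.
  move=> pB p1; rewrite -has_count has_map; apply/hasP.
  exists (nth (0, 0) (zip A B) (index p.2 B)).
    by rewrite zipP // sAB index_mem.
  rewrite nth_zip //= nth_index // in_setE /diagonal /= p1 mulr0 add0r mulVf //.
  by apply: contraNneq B0 => <-.
have k2 : (k = uphalf k + k./2)%N by rewrite uphalf_half -addnA addnn odd_double_half.
have hk : (k./2 <= uphalf k)%N by rewrite uphalf_half leq_addl.
have mulS x y : (0 < y)%N -> (x <= x * y)%N by move=> y0; rewrite leq_pmulr.
rewrite [leqLHS]k2.
case/andP: pG => /orP[/eqP p1|/[dup] pA /cV hV] /orP[/eqP p2|/[dup] pB /cW hW].
- by move: p0; rewrite [p]surjective_pairing p1 p2 eqxx.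
- apply: leq_add; apply: mulS; first exact: ltn_addl.
  exact: cD2.
- apply: leq_add; apply: mulS; first exact: ltn_addr.
  exact: cD1.
- apply: leq_trans (leq_addr _ _); rewrite mulnDr leq_add ?mulS //.
  exact: leq_trans hk (mulS _ _ hW).
Qed.

Lemma leq_ceil_half3 (R : realType) (k : nat) :
  ((2 * uphalf k + k./2)%:R : R) <= (Num.ceil (3 / 2 * k%:R : R))%:~R.
Proof.
set N := (_ + _)%N; rewrite -[N%:R]/((N%:Z)%:~R) ler_int.
rewrite -ltzD1 -ltrBlDr ceil_gt_int rmorphB /=.
have : (2 * N < 3 * k + 2)%N by rewrite /N; lia.
rewrite -(ltr_nat R) natrD !natrM -[N%:~R]/(N%:R : R); lra.
Qed.

(** * The lower bounds *)

Section LowerBounds.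
Context {R : realType} (k : nat) (G : {fset R * R}) (A B : seq R).
Hypotheses (uA : uniq A) (uB : uniq B) (A0 : 0 \notin A) (B0 : 0 \notin B).
Hypotheses (sAB : size A = size B) (A_gt0 : (0 < size A)%N).
Hypothesis sG : {subset grid (0 :: A) (0 :: B) <= G}.

Let m : R := (size A)%:R.
Let m_gt0 : 0 < m. Proof. by rewrite ltr0n. Qed.

Lemma cov_lower_generic (Delta : nat) : (Delta < 2 * size A)%N ->
  generic Delta G ->
  (2 - m / (2 * m - Delta%:R)) * k%:R * m <= (cov k G)%:R.
Proof.
move=> hD gen.
have d_gt0 : 0 < 2 * m - Delta%:R.
  by rewrite subr_gt0 /m -natrM ltr_nat.
have inc s t : s \in A -> t \in B -> (incidences A B s t <= Delta)%N.
  move=> sA tB.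
  have s0 : s != 0 by apply: contraNneq A0 => <-.
  have t0 : t != 0 by apply: contraNneq B0 => <-.
  have inG p : p.1 \in 0 :: A -> p.2 \in 0 :: B -> p \in G.
    by move=> pA pB; apply: sG; rewrite mem_grid pA.
  apply: leq_trans (gen _ (diagonal_line t s0) _).
    rewrite /incidences -size_filter; apply: uniq_leq_size.
      by rewrite filter_uniq // grid_uniq.
    move=> p; rewrite mem_filter mem_grid => /and3P[pL pA pB].
    rewrite !inE /= pL andbT inG ?inE ?pA ?pB ?orbT //=.
    rewrite /boundary negb_or; apply/andP; split.
      by apply: contraNneq A0 => <-.
    by apply: contraNneq B0 => <-.
  exists (s, 0), (0, t); split; split.
  - by apply: inG; rewrite !inE ?sA ?eqxx ?orbT.
  - by apply: inG; rewrite !inE ?tB ?eqxx ?orbT.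
  - by rewrite xpair_eqE (negPf s0).
  - by rewrite /boundary eqxx orbT.
  - by rewrite /boundary eqxx.
  - by rewrite /diagonal /= mulr0 addr0 mulVf.
  - by rewrite /diagonal /= mulr0 add0r mulVf.
(* For [size A < Delta] the boundary weight [1 - w * m] would be negative;
   since no line has more than [size A] interior points, [Delta] may be
   replaced by the minimum of both, which only strengthens the bound. *)
pose e := minn Delta (size A).
have [em eD] : e%:R <= m /\ e%:R <= Delta%:R :> R.
  by rewrite !ler_nat geq_minr geq_minl.
have e_gt0 : 0 < 2 * m - e%:R by lra.
pose w := (2 * m - e%:R)^-1.
have w_gt0 : 0 < w by rewrite invr_gt0.
have we : w * (2 * m - e%:R) = 1 by rewrite mulVf ?gt_eqF.
have wm : w * m <= 1 by rewrite -we (ler_wpM2l (ltW w_gt0)); lra.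
have := weighted_cov k (f := fun=> 1 - w * m) (g := fun=> 1 - w * m)
  (w := w) uA uB A0 B0 sAB A_gt0 sG.
move=> /(_ _ _ _ _ _ _) H; apply: le_trans (H _ _ _ _ _ _).
- rewrite !sum_const_count !count_predT -sAB -/m.
  rewrite [leLHS](_ : _ = k%:R * ((2 - m / (2 * m - Delta%:R)) * m)); last by ring.
  apply: ler_wpM2l => //.
  have : w * m <= m / (2 * m - Delta%:R).
    rewrite mulrC (ler_wpM2l (ltW m_gt0)) // lef_pV2 ?posrE //; lra.
  set z := m / _ => wz.
  rewrite [leRHS](_ : _ = (2 - w * m) * m); last by ring.
  by rewrite (ler_wpM2r (ltW m_gt0)); lra.
- by move=> s _; lra.
- by move=> s _; lra.
- exact: ltW.
- by move=> s _; rewrite -/m; lra.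
- by move=> s _; rewrite -/m; lra.
- move=> s t sA tB.
  have : (incidences A B s t)%:R <= e%:R :> R.
    rewrite ler_nat leq_min inc //=.
    by apply: ltnW; apply: incidences_lt.
  rewrite -(ler_pM2l w_gt0); nra.
Qed.

(** The weights have two levels, the lower one on the rich boundary points. The
    threshold [x * m] may fail to be an integer; rounding it down to [r] costs
    nothing, as an integer below [m - r] is at most [m - r - 1 < m - x * m]. *)
Lemma cov_lower : (10 - 4 * Num.sqrt 5) * k%:R * m <= (cov k G)%:R.
Proof.
set q := Num.sqrt 5.
have q2 : q ^+ 2 = 5 by rewrite sqr_sqrtr.
have q0 : 0 <= q by exact: sqrtr_ge0.
(* The bounds on [q] give [x > 0] and [0 < b < 1]. *)
have [q_gt2 q_lt] : 2 < q /\ q < 5 / 2 by split; nra.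
(* This [x] maximises [(1 + 2 x - 4 x^2) / (1 + x)]. *)
pose x := q / 2 - 1; pose b := 2 / 5 * q.
have bx : b * (1 + x) = 1.
  by rewrite /b /x; have : q * q = 5 by []; nra.
have xm0 : 0 <= x * m by rewrite (mulr_ge0 _ (ltW m_gt0)) // /x; lra.
set r := Num.truncn (x * m).
have /andP[r_le r_gt] := truncn_itv xm0.
pose richA s := has (fun t => size A <= incidences A B s t + r)%N B.
pose richB t := has (fun s => size B <= incidences B A t s + r)%N A.
have nA := count_rich r uA uB A0 B0 sAB.
have nB := count_rich r uB uA B0 A0 (esym sAB).
have sum_wt (rich : pred R) (S : seq R) : size S = size A ->
    (count rich S <= 4 * r)%N ->
    (1 - b) * m - (1 - b) / 2 * (4 * (x * m)) <=
      \sum_(s <- S) (if rich s then (1 - b) / 2 else 1 - b).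
  move=> eS hc.
  rewrite [leRHS](_ : _ = \sum_(s <- S) (1 - b) - \sum_(s <- S | rich s) (1 - b) / 2).
    rewrite !sum_const_count count_predT eS -/m.
    rewrite lerD2l lerN2 ler_wpM2l; [by []|rewrite /b; lra|].
    apply: (@le_trans _ _ (4 * r)%:R); first by rewrite ler_nat.
    by rewrite natrM ler_wpM2l.
  rewrite (big_mkcond rich) -sumrB; apply: eq_bigr => s _.
  by case: (rich s); rewrite ?subr0 //; field.
have := weighted_cov k
  (f := fun s => if richA s then (1 - b) / 2 else 1 - b)
  (g := fun t => if richB t then (1 - b) / 2 else 1 - b)
  (w := b / m) uA uB A0 B0 sAB A_gt0 sG.
have bm : b / m * m = b by rewrite divfK ?gt_eqF.
have b1 : b < 1 by rewrite /b; lra.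
have b0 : 0 < b by rewrite /b; lra.
move=> /(_ _ _ _ _ _ _) H; apply: le_trans (H _ _ _ _ _ _).
- have hA := sum_wt _ _ erefl nA; have hB := sum_wt _ _ (esym sAB) nB.
  rewrite [leLHS](_ : _ = k%:R * ((10 - 4 * q) * m)); last by ring.
  apply: ler_wpM2l => //; apply: le_trans (lerD (lerD hA hB) (lexx _)).
  have -> : b / m * (size A)%:R ^+ 2 = b * m by rewrite expr2 mulrA bm.
  rewrite [leRHS](_ : _ = (2 - b - 4 * x * (1 - b)) * m); last by field.
  rewrite (ler_wpM2r (ltW m_gt0)) // /x /b; have : q * q = 5 by []; lra.
- by move=> s _; case: ifP => _; lra.
- by move=> s _; case: ifP => _; lra.
- by rewrite divr_ge0 ?ltW.
- by move=> s _; rewrite -/m bm; case: ifP => _; lra.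
- by move=> s _; rewrite -/m bm; case: ifP => _; lra.
move=> s t sA tB.
have lem : (incidences A B s t)%:R <= m.
  by rewrite ler_nat ltnW // incidences_lt.
have w_gt0 : 0 < b / m by rewrite divr_gt0.
have [rich|poor] := leqP (size A) (incidences A B s t + r).
  have -> : richA s by apply/hasP; exists t.
  have -> : richB t.
    by apply/hasP; exists s => //; rewrite -sAB incidencesC.
  by move: lem; rewrite -(ler_pM2l w_gt0) bm; lra.
have : (incidences A B s t)%:R <= m - x * m.
  move: poor; rewrite -addnS -(ler_nat R) natrD -/m; lra.
rewrite -(ler_pM2l w_gt0) mulrBr (mulrCA _ x) bm.
by case: ifP => _; case: ifP => _; lra.
Qed.

End LowerBounds.

Theorem theorem1p3 (R : realType) :
  exists o1 : nat -> R, o1 n @[n --> \oo] --> (0 : R) /\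
  forall (n : nat) (S1 S2 : {fset R}), (2 <= n)%N ->
    #|` S1| = n -> #|` S2| = n -> 0 \in S1 -> 0 \in S2 ->
  let G : {fset R * R} := (S1 `*` S2)%fset in
  forall k : nat, (2 <= k)%N ->
  [/\ ((cov k G)%:R : R) <=
        (Num.ceil (3 / 2 * k%:R : R))%:~R * (n%:R - 1),
      ((cov k G)%:R : R) >=
        (10 - 4 * Num.sqrt 5 + o1 n) * k%:R * (n%:R - 1)
    & forall Delta : nat, (Delta < 2 * (n - 1))%N -> generic Delta G ->
        ((cov k G)%:R : R) >=
          (2 - (n%:R - 1) / (2 * (n%:R - 1) - Delta%:R)) * k%:R * (n%:R - 1)].
Proof.
exists (fun=> 0); split; first exact: cvg_cst.
move=> n S1 S2 n2 c1 c2 z1 z2 G k _.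
pose A : seq R := (S1 `\ 0)%fset; pose B : seq R := (S2 `\ 0)%fset.
have sA : size A = (n - 1)%N by move: c1; rewrite (cardfsD1 0) z1 -[size A]/#|` _|; lia.
have sB : size B = (n - 1)%N by move: c2; rewrite (cardfsD1 0) z2 -[size B]/#|` _|; lia.
have memS (S : {fset R}) x : 0 \in S -> (x \in 0 :: ((S `\ 0)%fset : seq R)) = (x \in S).
  move=> zS; rewrite inE -[x \in (_ : seq R)]/(x \in (S `\ 0)%fset) in_fsetD1.
  by have [->|] := eqVneq x 0.
have memG : grid (0 :: A) (0 :: B) =i G.
  by move=> p; rewrite mem_grid !memS // in_fsetM.
have uA : uniq A by exact: fset_uniq.
have uB : uniq B by exact: fset_uniq.
have A0 : 0 \notin A by rewrite -[_ \in A]/(0 \in (S1 `\ 0)%fset) in_fsetD1 eqxx.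
have B0 : 0 \notin B by rewrite -[_ \in B]/(0 \in (S2 `\ 0)%fset) in_fsetD1 eqxx.
have sAB : size A = size B by rewrite sA sB.
have A_gt0 : (0 < size A)%N by rewrite sA; lia.
have sG : {subset grid (0 :: A) (0 :: B) <= G} by move=> p; rewrite memG.
have -> : n%:R - 1 = (size A)%:R :> R by rewrite sA natrB //; lia.
rewrite addr0 -sA; split; first 1 last.
- exact: (cov_lower k uA uB A0 B0 sAB A_gt0 sG).
- by move=> Delta; exact: (cov_lower_generic k uA uB A0 B0 sAB A_gt0 sG).
apply: le_trans (ler_wpM2r _ (leq_ceil_half3 R k)) => //.
rewrite -natrM ler_nat; apply: (cov_upper k A0 B0 sAB) => p.
by rewrite memG.
Qed.
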